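(* Assume that $\mathfrak{b}=\mathfrak{c}$. There is a $\mathfrak{b}$-unbounded set $S\subseteq[\mathbb{N}]^\infty$ such that the set $S\cup\mathrm{Fin}$ (as a subspace of $P(\mathbb{N})$) is $\mathsf{U}_{\mathrm{fin}}(\mathrm{O},\Gamma)$ and $\mathsf{S}_1(\Gamma,\mathrm{O})$ but not $\mathsf{U}_{\mathrm{id}}(\Gamma,\Gamma)$.
   Context: $\mathbb{N}=\{1,2,\dots\}$. $P(\mathbb{N})$ carries the Cantor space topology (identify sets with characteristic functions in $\{0,1\}^{\mathbb{N}}$). $\mathrm{Fin}$ is the family of finite subsets of $\mathbb{N}$, and $[\mathbb{N}]^\infty$ the family of infinite subsets. Each $a\in[\mathbb{N}]^\infty$ is identified with its increasing enumeration $a(1)<a(2)<\cdots$. For $a,b\in\mathbb{N}^{\mathbb{N}}$, $a\le b$ means $a(n)\le b(n)$ for all $n$, and $a\le^* b$ means $a(n)\le b(n)$ for all but finitely many $n$. $\mathfrak{b}$ is the minimal cardinality of a subset of $\mathbb{N}^{\mathbb{N}}$ with no $\le^*$-upper bound in $\mathbb{N}^{\mathbb{N}}$, and $\mathfrak{c}=2^{\aleph_0}$. For an uncountable cardinal $\kappa$, a set $S\subseteq[\mathbb{N}]^\infty$ is $\kappa$-unbounded if $|S|\ge\kappa$ and, for each $b\in\mathbb{N}^{\mathbb{N}}$, $|\{s\in S:s\le b\}|<\kappa$. Spaces are infinite Hausdorff. A cover of a space $X$ is a family $\mathcal{U}$ of subsets of $X$ with $X=\bigcup\mathcal{U}$ and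 $X\notin\mathcal{U}$. $\mathrm{O}(X)$ is the family of open covers of $X$. $\Gamma(X)$ is the family of infinite open covers $\mathcal{U}$ of $X$ such that each $x\in X$ belongs to all but finitely many members of $\mathcal{U}$. A space $X$ is: - $\mathsf{S}_1(\Gamma,\mathrm{O})$ if for all $\mathcal{U}_1,\mathcal{U}_2,\dots\in\Gamma(X)$ there are $U_n\in\mathcal{U}_n$ with $\{U_n:n\in\mathbb{N}\}\in\mathrm{O}(X)$; - $\mathsf{U}_{\mathrm{fin}}(\mathrm{O},\Gamma)$ if for all $\mathcal{U}_1,\mathcal{U}_2,\dots\in\mathrm{O}(X)$, none having a finite subcover, there are finite $\mathcal{F}_n\subseteq\mathcal{U}_n$ with $\{\bigcup\mathcal{F}_n:n\in\mathbb{N}\}\in\Gamma(X)$; - $\mathsf{U}_{\mathrm{id}}(\Gamma,\Gamma)$ if for all $\mathcal{U}_1,\mathcal{U}_2,\dots\in\Gamma(X)$, none having a finite subcover, there are $\mathcal{F}_n\subseteq\mathcal{U}_n$ with $|\mathcal{F}_n|\le n$ for all $n$ and $\{\bigcup\mathcal{F}_n:n\in\mathbb{N}\}\in\Gamma(X)$. *)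

(* Defs.v *)
From mathcomp Require Import all_boot.
From mathcomp Require Import boolp classical_sets functions cardinality.
From mathcomp Require Import topology cantor.

Set Implicit Arguments.
Unset Strict Implicit.
Unset Printing Implicit Defensive.

Local Open Scope classical_set_scope.
Local Open Scope card_scope.

(* The positive integers are represented by [nat] through n |-> n - 1; both
   the indices and the values of sequences of positive integers are shifted.
   A cardinal is represented by any set having that cardinality. *)

Definition card_lt (T U : Type) (A : set T) (B : set U) : Prop :=
  (A #<= B) /\ ~ (B #<= A).

Definition le_star (a b : nat -> nat) : Prop :=
  finite_set [set n | ~ (a n <= b n)%N].

Definition star_unbounded (B : set (nat -> nat)) : Prop :=
  ~ exists g : nat -> nat, forall f, B f -> le_star f g.

(* kappa has cardinality b. *)
Definition is_bfrak (T : Type) (kappa : set T) : Prop :=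
  (exists B : set (nat -> nat), star_unbounded B /\ (B #= kappa)) /\
  (forall B : set (nat -> nat), star_unbounded B -> kappa #<= B).

Definition carrier (a : cantor_space) : set nat := [set n | a n].

Definition Fin : set cantor_space := [set a | finite_set (carrier a)].

Definition infinite_subsets : set cantor_space :=
  [set a | infinite_set (carrier a)].

(* The increasing enumeration of a; a junk value when a is finite. *)
Definition enumeration (a : cantor_space) : nat -> nat :=
  xget (fun=> 0%N)
    [set f : nat -> nat | {homo f : m n / (m < n)%N} /\ range f = carrier a].

Definition card_unbounded (T : Type) (kappa : set T) (S : set cantor_space) :
    Prop :=
  [/\ S `<=` infinite_subsets, kappa #<= S &
      forall b : nat -> nat,
        card_lt [set s | S s /\ forall n, (enumeration s n <= b n)%N] kappa].

Section Covers.
Variable X : topologicalType.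
Implicit Types U F : set (set X).

Definition cover U : Prop := \bigcup_(u in U) u = setT /\ ~ U setT.

Definition open_cover U : Prop := cover U /\ forall u, U u -> open u.

Definition gamma_cover U : Prop :=
  [/\ infinite_set U, open_cover U &
      forall x : X, finite_set [set u | U u /\ ~ u x]].

Definition has_finite_subcover U : Prop :=
  exists F, [/\ F `<=` U, finite_set F & cover F].

End Covers.

Definition S1_Gamma_O (X : topologicalType) : Prop :=
  forall U : nat -> set (set X), (forall n, gamma_cover (U n)) ->
  exists u : nat -> set X, (forall n, U n (u n)) /\ open_cover (range u).

Definition Ufin_O_Gamma (X : topologicalType) : Prop :=
  forall U : nat -> set (set X),
    (forall n, open_cover (U n)) -> (forall n, ~ has_finite_subcover (U n)) ->
  exists F : nat -> set (set X),
    (forall n, F n `<=` U n /\ finite_set (F n)) /\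
    gamma_cover (range (fun n => \bigcup_(u in F n) u)).

(* The index n stands for the positive integer n.+1, hence the bound n.+1. *)
Definition Uid_Gamma_Gamma (X : topologicalType) : Prop :=
  forall U : nat -> set (set X),
    (forall n, gamma_cover (U n)) -> (forall n, ~ has_finite_subcover (U n)) ->
  exists F : nat -> set (set X),
    (forall n, F n `<=` U n /\ (F n #<= `I_n.+1)) /\
    gamma_cover (range (fun n => \bigcup_(u in F n) u)).

(* Main.v *)
Require Import Defs.
From mathcomp Require Import all_boot.
From mathcomp Require Import boolp classical_sets functions cardinality.
From mathcomp Require Import wochoice topology cantor.
From mathcomp Require Import zify.

(** Why the theorem holds.

Call [s] gappy for a fast growing function [K] if, from every large [n] on, a
gap of [s] of the form [[m, K m)] starts at some [m] between [n] and a bound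
[escape K n] that depends on [K] and [n] alone.  The set [S] is built so that
every [K] has fewer than b elements of [S] that are not gappy for it.  This
single concentration property gives three of the four conclusions.

- [S] is b-unbounded: a gap [[m, K m)] forces the increasing enumeration to
  jump over [K m] at an index at most [m], so no element that is gappy for a
  [K] outgrowing [f] is bounded by [f] ([gappy_not_le_star]).
- If open sets cover all finite sets, compactness of the set of subsets of
  [[0, m)] yields [k m] such that every set without elements in [[m, k m)] lies
  in one of them ([gap_capture]).  So a countable part of the covers, chosen
  to cover Fin, already covers every gappy point, and the fewer than b
  remaining points are handled by the definition of b.  That is S_1(Gamma, O)
  ([concentrated_S1]).
- The bound on the position of the gap is the same for all gappy points.
  Hence the n-th finite subfamily can be chosen to contain all of them from
  some [n] on, which is U_fin(O, Gamma) ([concentrated_Ufin]).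

To defeat U_id(Gamma, Gamma), fix [n] and consider for [m >= n] the clopen set
of those [x] for which [m] is not marked, where [m] in [x] is [marked] if it
is among the first n + 1 elements of [x] from [n] on, or if [x] contains all
of [[n, m]].  A coinfinite set has finitely many marked elements, so these
clopen sets form a gamma-cover, and an interval [[n, n + M]] shows that it
has no finite subcover.  A selection of n + 1 members amounts to a list [D n]
of n + 1 numbers, and it misses [x] as soon as [D n] consists of elements of
[x] and [x] has at most [n] elements from [n] up to any of them.  So it is
enough that every sequence [D] of such lists is [caught] infinitely often by
some [s] in [S] ([catching_not_Uid]).

Both demands on [S] are compatible.  The union of blocks [D n_0], [D n_1], ...
catches [D], and if [n_(i+1)] is large compared with the maximum of the i-th
block, the blocks have room between them ([block_union]).  Inside a block
there are gaps as well, because a block that starts at [n] has at most n + 1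
elements: among more than n + 1 consecutive intervals [[K^j n, K^(j+1) n)] one
is missed ([sparse_gappy]).

Finally, index the pairs (block sequence, growth function) by a set of
size c = b, ordered so that initial segments have fewer than b elements.
The set [s a] uses the block sequence of [a] and a function that dominates the
growth functions of all indices up to [a]; it exists because they are fewer
than b many ([sparse_catching_family]).
*)

Set Implicit Arguments.
Unset Strict Implicit.
Unset Printing Implicit Defensive.

Local Open Scope classical_set_scope.
Local Open Scope card_scope.

Definition infinitely_often (P : nat -> Prop) : Prop :=
  forall N, exists2 n, (N <= n)%N & P n.

Lemma finite_nat_bounded (A : set nat) :
  finite_set A <-> exists N, forall n, A n -> (n < N)%N.
Proof.
split=> [/finite_seqP[l ->]|[N HN]].
  exists (\max_(i <- l) i).+1 => i /= il; rewrite ltnS.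
  exact: (@leq_bigmax_seq _ l xpredT id i).
by apply: (@sub_finite_set _ _ `I_N) => //; exact: finite_II.
Qed.

(** * Orders with small initial segments *)

Lemma card_le_inj (T U : Type) (A : set T) (B : set U) (f : T -> U) :
  (forall a, A a -> B (f a)) -> {in A &, injective f} -> A #<= B.
Proof.
move=> fAB finj.
have [g] : $|{injfun A >-> B}| by apply/injfunPex; exists f.
exact: inj_card_le.
Qed.

(** A well-order of [W] may have initial segments as large as [W].  Then [W]
    embeds into the least such segment, and the order pulled back along this
    embedding has only smaller initial segments. *)
Lemma small_initial_segments (W : Type) : exists R : W -> W -> Prop,
  [/\ forall x y, [\/ R x y, x = y | R y x], forall x, ~ R x x &
      forall x, ~ ([set: W] #<= [set y | R y x])].
Proof.
elim/Ppointed: W => W.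
  by exists (fun _ _ => False); split=> x; case: (no x).
have [le wo] := well_ordering_principle W.
pose R x y := le x y /\ x <> y.
have totR x y : [\/ R x y, x = y | R y x].
  have [-> |/eqP xy] := eqVneq x y; first exact: Or32.
  have [|z [[zxy lb] _]] := wo [pred z | (z == x) || (z == y)].
    by exists x; rewrite inE eqxx.
  move: zxy; rewrite inE => /orP[]/eqP zE; subst z.
    by apply: Or31; split => //; apply: lb; rewrite inE eqxx orbT.
  by apply: Or33; split; [apply: lb; rewrite inE eqxx|exact/nesym].
have [[x0 Hx0]|small] := pselect (exists x, [set: W] #<= [set y | R y x]);
    last first.
  by exists R; split=> // [x []//|x Hx]; apply: small; exists x.
have [|z [[zL lb] _]] := wo [pred x | `[< [set: W] #<= [set y | R y x] >]].
  by exists x0; apply/asboolP.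
have /pcard_leP[f] : [set: W] #<= [set y | R y z] by exact: (asboolW zL).
have finj : injective f by move=> x y fxy; apply: (@inj _ _ _ f); rewrite ?inE.
exists (fun x y => R (f x) (f y)); split=> [x y|x []//|x Hx].
  have [? | fxy | ?] := totR (f x) (f y); [exact: Or31|apply: Or32|exact: Or33].
  exact: finj.
have [lefz fz] : R (f x) z by exact: (@funS _ _ _ _ f).
have lezf : le z (f x).
  apply: lb; apply/asboolP/(card_le_trans Hx).
  by apply: (@card_le_inj _ _ _ _ f) => // a b _ _; exact: finj.
have lexx a : le a a.
  have [|c [[/eqP -> lbc] _]] := wo (pred1 a); first by exists a; rewrite inE.
  by apply: lbc; rewrite inE.
have [|c [_ uc]] := wo [pred y | (y == z) || (y == f x)].
  by exists z; rewrite inE eqxx.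
apply: fz; apply: (@etrans _ _ c); [apply: esym|]; apply: uc; split;
  rewrite ?inE ?eqxx ?orbT //.
  by move=> y; rewrite inE => /orP[]/eqP ->.
by move=> y; rewrite inE => /orP[]/eqP ->.
Qed.

Implicit Types (s x y : cantor_space).

(** * Open sets of subspaces of the Cantor space *)

Lemma set_type_point (T : Type) (A : set T) (a : T) : A a ->
  exists z : set_type A, set_val z = a.
Proof. by move=> Aa; exists (exist _ a (mem_set Aa)). Qed.

Definition agree (d : nat) (x y : cantor_space) : Prop :=
  forall i, (i < d)%N -> x i = y i.

Lemma agree_weaken d e x y : (d <= e)%N -> agree e x y -> agree d x y.
Proof. by move=> de xy i id; apply: xy; exact: leq_trans de. Qed.

Lemma agree_trans d x y z : agree d x y -> agree d y z -> agree d x z.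
Proof. by move=> xy yz i id; rewrite xy // yz. Qed.

Lemma agree_sym d x y : agree d x y -> agree d y x.
Proof. by move=> xy i id; rewrite xy. Qed.

Lemma open_agree x d : open [set y | agree d x y].
Proof.
elim: d => [|d IH].
  rewrite (_ : mkset _ = setT); first exact: openT.
  by apply/seteqP; split => // y _ i.
rewrite (_ : mkset _ = [set y : cantor_space | agree d x y] `&`
    (fun y => (y d : discrete_topology bool)) @^-1` [set x d]);
    last first.
  apply/seteqP; split => y /=.
    move=> H; split; last by rewrite /= H.
    by move=> i id; apply: H; lia.
  move=> [H /= yd] i; rewrite ltnS leq_eqVlt => /orP[/eqP -> //|]; exact: H.
apply: openI => //.
apply: open_comp; last exact: discrete_open.
by move=> y _; exact: (@proj_continuous nat (fun=> discrete_topology bool) d).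
Qed.

Lemma open_locally_agree (u : set cantor_space) x : open u -> u x ->
  exists d, forall y, agree d x y -> u y.
Proof.
move=> ou ux.
pose F : set_system cantor_space :=
  [set A | exists d, forall y, agree d x y -> A y].
have FF : Filter F.
  split; first by exists 0%N.
    move=> P Q [d Hd] [e He]; exists (maxn d e) => y xy; split.
      by apply: Hd => i id; apply: xy; lia.
    by apply: He => i id; apply: xy; lia.
  by move=> P Q PQ [d Hd]; exists d => y /Hd /PQ.
suff : F --> x by apply; exact: open_nbhs_nbhs.
apply/cvg_sup => i A [B [[C oC <-] Bx BA]].
by exists i.+1 => y xy; apply: BA; rewrite /= -(xy i).
Qed.

(** The cylinders form a base: openness becomes a statement about finite
    initial parts of the points, which is all that the covers need. *)
Lemma open_set_typeP (A : set cantor_space) (u : set (set_type A)) :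
  open u <-> forall y : set_type A, u y ->
    exists d, forall z, agree d (set_val y) (set_val z) -> u z.
Proof.
split=> [[v ov <-] y uy|H].
  by have [d Hd] := open_locally_agree ov uy; exists d => z /Hd.
exists (\bigcup_(p in [set p : cantor_space * nat |
     forall z : set_type A, agree p.2 p.1 (set_val z) -> u z])
       [set y : cantor_space | agree p.2 p.1 y]).
  by apply: bigcup_open => p _; exact: open_agree.
apply/seteqP; split => y /=; first by move=> [p /= Hp]; exact: Hp.
by move=> /H[d Hd]; exists (set_val y, d).
Qed.

(** * Gaps of sparse sets *)

Definition cnt (s : cantor_space) (n m : nat) : nat := \sum_(n <= i < m) s i.

Lemma cnt_cat s n m p : (n <= m)%N -> (m <= p)%N ->
  cnt s n p = (cnt s n m + cnt s m p)%N.
Proof. by move=> nm mp; rewrite /cnt (big_cat_nat nm mp). Qed.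

Lemma leq_cnt s n m p : (m <= p)%N -> (cnt s n m <= cnt s n p)%N.
Proof.
move=> mp; have [nm|/ltnW mn] := leqP n m.
  by rewrite (cnt_cat s nm mp) leq_addr.
by rewrite /cnt big_geq.
Qed.

Lemma cnt_gt0 s n m i : (n <= i < m)%N -> s i -> (0 < cnt s n m)%N.
Proof.
move=> /andP[ni im] si.
rewrite (cnt_cat s ni (ltnW im)) (cnt_cat s (leqnSn i) im).
by rewrite {2}/cnt big_nat1 si; lia.
Qed.

Definition gap (s : cantor_space) (n m : nat) : Prop :=
  forall i, (n <= i < m)%N -> ~~ s i.

Lemma cnt0_gap s n m : cnt s n m = 0%N -> gap s n m.
Proof. by move=> c i nim; apply/negP => /(cnt_gt0 nim); rewrite c. Qed.

(** The bound [a.+1] is the size allowed for a block that starts at [a]; it is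
    tied to [a], not to [n], since the next block may start far beyond [n]. *)
Definition sparse_for (g : nat -> nat) (s : cantor_space) : Prop :=
  exists N, forall n, (N <= n)%N ->
    exists a, gap s n a /\ (cnt s n (g n) <= a.+1)%N.

(** Starting at [n], either nothing of [s] lies below [K n], or the next block
    starts before [K n] and has at most [K n] elements; then [(K n).+2] steps
    of [K] are more than the block can hit. *)
Definition escape (K : nat -> nat) (n : nat) : nat := iter (K n).+2 K n.

Definition gappy (K : nat -> nat) (s : cantor_space) : Prop :=
  exists N, forall n, (N <= n)%N ->
    exists m, (n <= m <= escape K n)%N /\ gap s m (K m).

Lemma leq_iter (K : nat -> nat) (KS : forall n, (n < K n)%N) j n :
  (n + j <= iter j K n)%N.
Proof. by elim: j => [|j IH] /=; [lia|have := KS (iter j K n); lia]. Qed.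

Lemma leq_iter_mono (K : nat -> nat) (KS : forall n, (n < K n)%N) i j n :
  (i <= j)%N -> (iter i K n <= iter j K n)%N.
Proof.
move=> ij; rewrite -(subnK ij) iterD.
by have := leq_iter KS (j - i) (iter i K n); lia.
Qed.

Lemma pigeonhole_gap (K : nat -> nat) (KS : forall n, (n < K n)%N) s n j :
  (cnt s n (iter j K n) < j)%N ->
  exists2 i, (i < j)%N & gap s (iter i K n) (K (iter i K n)).
Proof.
elim: j => // j IH.
have := @cnt_cat s n (iter j K n) (iter j.+1 K n).
have h1 : (n <= iter j K n)%N by have := leq_iter KS j n; lia.
rewrite (leq_iter_mono KS _ (leqnSn j)) h1 => -> // c.
have [c0|cp] := posnP (cnt s (iter j K n) (iter j.+1 K n)).
  by exists j => //; exact: cnt0_gap.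
have [|i ij gi] := IH; first lia.
by exists i => //; exact: ltnW.
Qed.

Lemma sparse_gappy (K : nat -> nat) (KS : forall n, (n < K n)%N) s :
  sparse_for (escape K) s -> gappy K s.
Proof.
move=> [N HN]; exists N => n /HN[a [ga ca]].
have [Ka|aK] := leqP (K n) a.
  exists n; rewrite leqnn /escape.
  split; first by have := leq_iter KS (K n).+2 n; lia.
  by move=> i /andP[? ?]; apply: ga; lia.
have [|i ij gi] := @pigeonhole_gap K KS s n (K n).+2.
  by rewrite -/(escape K n); lia.
exists (iter i K n); split => //.
have := leq_iter KS i n; have := leq_iter_mono KS n (ltnW ij).
by rewrite /escape; lia.
Qed.

Lemma sparse_for_le (g h : nat -> nat) s N :
  (forall n, (N <= n)%N -> (g n <= h n)%N) -> sparse_for h s -> sparse_for g s.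
Proof.
move=> gh [M HM]; exists (maxn N M) => n nNM.
have [|a [ga ca]] := HM n; first lia.
exists a; split => //; apply: leq_trans ca; apply: leq_cnt; apply: gh; lia.
Qed.

Definition trunc (m : nat) (x : cantor_space) : cantor_space :=
  fun i => (i < m)%N && x i.

Lemma Fin_bounded x : Fin x <-> exists M, forall i, x i -> (i < M)%N.
Proof. exact: finite_nat_bounded. Qed.

Lemma trunc_Fin m x : Fin (trunc m x).
Proof. by apply/Fin_bounded; exists m => i /andP[]. Qed.

(** Compactness in the form needed here.  For a fixed [m] there are finitely
    many subsets of [[0, m)], each in some [W d]; take [k m] to be the maximum
    of these [d].  A point with no elements in [[m, e)] agrees up to [e] with
    one of these finite sets, and [W e] sees only the part below [e]. *)
Lemma gap_capture (W : nat -> set cantor_space) :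
  (forall d e x, (d <= e)%N -> W d x -> W e x) ->
  (forall d x y, agree d x y -> W d x -> W d y) ->
  (forall x, Fin x -> exists d, W d x) ->
  exists k : nat -> nat, forall m x e, (k m <= e)%N -> gap x m e -> W e x.
Proof.
move=> Wmono Wagree WFin.
have /choice[d Hd] : forall x, exists d, Fin x -> W d x.
  move=> x; have [/WFin[d ?]|nF] := pselect (Fin x); first by exists d.
  by exists 0%N.
pose ext m (t : m.-tuple bool) : cantor_space := nth false t.
exists (fun m => \max_(t : m.-tuple bool) d (ext m t)) => m x e ke g.
pose t := [tuple x i | i < m].
have tE i : ext m t i = trunc m x i.
  rewrite /ext /trunc; case: ltnP => im; last first.
    by rewrite nth_default ?size_tuple.
  by rewrite -[i]/(val (Ordinal im)) -tnth_nth tnth_mktuple.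
have Ft : Fin (ext m t).
  by rewrite (_ : ext m t = trunc m x); [exact: trunc_Fin|exact/funext].
apply: (Wagree e (ext m t)).
  move=> i ie; rewrite tE /trunc; case: ltnP => //= mi.
  by apply/esym/negbTE/g; rewrite mi.
apply: Wmono (Hd _ Ft); apply: leq_trans ke.
exact: (@leq_bigmax _ (fun t => d (ext m t))).
Qed.

(** * Unions of sparse blocks *)

Definition majorant (f : nat -> nat) (n : nat) : nat :=
  n.+1 + \sum_(i < n.+1) f i.

Lemma majorant_gt f n : (n < majorant f n)%N.
Proof. by rewrite /majorant; lia. Qed.

Lemma majorant_ge f n m : (n <= m)%N -> (f n <= majorant f m)%N.
Proof.
move=> nm; rewrite /majorant (bigD1 (Ordinal (nm : (n < m.+1)%N))) //=; lia.
Qed.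

Lemma majorant_mono f n m : (n <= m)%N -> (majorant f n <= majorant f m)%N.
Proof.
move=> nm; rewrite /majorant leq_add ?ltnS//.
rewrite -!(big_mkord xpredT) (@big_cat_nat _ _ _ n.+1 _ m.+1) //=.
exact: leq_addr.
Qed.

(** [D n] stands for a selection of at most [n.+1] members of the n-th cover;
    the empty list stands for an index to be skipped. *)
Definition block (D : nat -> seq nat) (n : nat) : Prop :=
  [/\ D n <> [::], (size (D n) <= n.+1)%N & forall m, m \in D n -> (n <= m)%N].

(** The bound [cnt s n m <= n] says that [m] is one of the first [n.+1] elements
    of [s] from [n] on. *)
Definition caught (D : nat -> seq nat) (s : cantor_space) (n : nat) : Prop :=
  forall m, m \in D n -> s m /\ (cnt s n m <= n)%N.

Lemma cnt_le_size s n p (l : seq nat) :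
  (forall m, (n <= m < p)%N -> s m -> m \in l) -> (cnt s n p <= size l)%N.
Proof.
move=> H; rewrite /cnt -big_mkcondr /=.
rewrite sum1_count -size_filter; apply: uniq_leq_size.
  by rewrite filter_uniq ?iota_uniq.
by move=> m; rewrite mem_filter mem_index_iota => /andP[sm /H]; exact.
Qed.

(** The set is the union of the blocks [D (a i)], where [a i.+1] exceeds [h] on
    all arguments up to [top (a i)], the last element of the previous block.
    Below [h n] at most one block from [n] on is then visible, and its
    size is bounded by its starting point. *)
Lemma block_union (h : nat -> nat) (D : nat -> seq nat) :
  infinitely_often (block D) ->
  exists s : cantor_space,
  [/\ infinitely_often (fun n => s n),
      infinitely_often (fun n => ~~ s n),
      sparse_for h s &
      infinitely_often (fun n => block D n /\ caught D s n)].
Proof.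
move=> HD; have /choice[v Hv] : forall N, exists n, (N <= n)%N /\ block D n.
  by move=> N; have [n] := HD N; exists n.
have vge N : (N <= v N)%N by case: (Hv N).
have vblock N : block D (v N) by case: (Hv N).
pose top n := \max_(m <- D n) m.
have top_ge n m : m \in D n -> (m <= top n)%N.
  by move=> mD; exact: (@leq_bigmax_seq _ (D n) xpredT id m).
pose a := fix a i := if i is j.+1 then v (majorant h (top (a j))).+1 else v 0%N.
have ab i : block D (a i) by case: i => [|i]; exact: vblock.
have a_le i m : m \in D (a i) -> (a i <= m)%N by case: (ab i) => _ _; exact.
have Dhead i : exists m, m \in D (a i).
  by case: (ab i); case: (D _) => // m l _ _ _; exists m; rewrite inE eqxx.
have a_top i : (a i <= top (a i))%N.
  by have [m mD] := Dhead i; exact: leq_trans (a_le _ _ mD) (top_ge _ _ mD).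
have aS i : (majorant h (top (a i)) < a i.+1)%N by exact: vge.
have topS i : ((top (a i)).+1 < a i.+1)%N.
  exact: leq_ltn_trans (majorant_gt _ _) (aS i).
have a_mono i j : (i <= j)%N -> (a i <= a j)%N.
  elim: j => [|j IH]; first by rewrite leqn0 => /eqP ->.
  rewrite leq_eqVlt => /orP[/eqP -> //|]; rewrite ltnS => /IH.
  by have := topS j; have := a_top j; lia.
have top_mono i j : (i <= j)%N -> (top (a i) <= top (a j))%N.
  rewrite leq_eqVlt => /orP[/eqP -> //|/a_mono].
  by have := topS i; have := a_top j; lia.
have i_top i : (i <= top (a i))%N.
  by elim: i => // i IH; have := topS i; have := a_top i.+1; lia.
pose s : cantor_space := fun m => `[< exists i, m \in D (a i) >].
have sP m : s m <-> exists i, m \in D (a i) by split => /asboolP.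
(* Between the ends of two consecutive blocks there is only one block. *)
have s_loc i m : (forall j, (j < i)%N -> (top (a j) < m)%N) -> (m < a i.+1)%N ->
    s m -> m \in D (a i).
  move=> lo hi /sP[j mj].
  have [ji|ij|<- //] := ltngtP j i.
    by have := lo _ ji; have := top_ge _ _ mj; lia.
  by have := a_mono _ _ ij; have := a_le _ _ mj; lia.
exists s; split.
- move=> N; have [m mD] := Dhead N.+1.
  exists m; last by apply/sP; exists N.+1.
  by have := a_le _ _ mD; have := topS N; have := i_top N; lia.
(* The strict inequality [topS] leaves a hole right after each block. *)
- move=> N; exists (top (a N)).+1; first by have := i_top N; lia.
  apply/negP => /(@s_loc N) -/(_ _ (topS N)) H.
  suff /H/top_ge : forall j, (j < N)%N -> (top (a j) < (top (a N)).+1)%N by lia.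
  by move=> j /ltnW /top_mono.
- exists 0%N => n _.
  have exi : exists i, (n <= top (a i))%N by exists n.
  case: (ex_minnP exi) => i ni imin.
  have lo j : (j < i)%N -> (top (a j) < n)%N.
    by move=> ji; rewrite ltnNge; apply/negP => /imin; lia.
  exists (a i); split.
    move=> m /andP[nm mi]; apply/negP => sm.
    suff /a_le : m \in D (a i) by lia.
    apply: s_loc sm; first by move=> j /lo; lia.
    by have := topS i; have := a_top i; lia.
  have [_ + _] := ab i; apply: leq_trans.
  apply: cnt_le_size => m /andP[nm mh] sm; apply: s_loc sm.
    by move=> j /lo; lia.
  by have := majorant_ge h ni; have := aS i; lia.
- move=> N; exists (a N.+1); first by have := topS N; have := i_top N; lia.
  split=> // m mD; have sm : s m by apply/sP; exists N.+1.
  split => //; rewrite -ltnS.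
  have [_ + _] := ab N.+1; apply: leq_trans.
  have aNm := a_le _ _ mD.
  have <- : cnt s (a N.+1) m.+1 = (cnt s (a N.+1) m).+1.
    by rewrite (cnt_cat s aNm (leqnSn m)) {2}/cnt big_nat1 sm addn1.
  apply: cnt_le_size => p /andP[ap pm] sp; apply: s_loc sp.
    by move=> j; rewrite ltnS => /top_mono; have := topS N; lia.
  by have := top_ge _ _ mD; have := topS N.+1; lia.
Qed.

(** * A concentrated family that catches all block sequences *)

Lemma le_starP f g :
  le_star f g <-> exists N, forall n, (N <= n)%N -> (f n <= g n)%N.
Proof.
rewrite /le_star finite_nat_bounded; split=> -[N HN]; exists N => n.
  by move=> Nn; apply: contrapT => /HN; rewrite ltnNge Nn.
by move=> nfg; rewrite ltnNge; apply/negP => /HN.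
Qed.

Lemma card_graph (V : countType) : [set: nat -> V] #<= [set: nat -> bool].
Proof.
pose G (f : nat -> V) (k : nat) : bool :=
  if unpickle k is Some (n, v) then f n == v else false.
apply: (@card_le_inj _ _ _ _ G) => // f g _ _ fg; apply/funext => n.
have /(congr1 (fun F => F (pickle (n, f n)))) := fg.
by rewrite /G pickleK eqxx => /esym/eqP.
Qed.

(** One index codes both a block sequence [D] and a growth function, the sizes
    of its entries.  The block sequence of an index is used for that index
    alone, while its growth function is respected by all later indices; hence
    one index may play both roles at once. *)
Definition datum : Type := nat -> seq nat.

(** The minimality of b enters here: a family indexed by fewer than b
    elements has a bound modulo finite. *)
Lemma small_bounded (T : Type) (kappa : set T) (I : Type) (A : set I)
    (Phi : I -> nat -> nat) : is_bfrak kappa -> ~ (kappa #<= A) ->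
  exists f, forall i, A i -> le_star (Phi i) f.
Proof.
move=> [_ bmin] nA; apply: contrapT => nf.
have /bmin H : star_unbounded (Phi @` A).
  by move=> [f Hf]; apply: nf; exists f => i Ai; apply: Hf; exists i.
by apply: nA; apply: card_le_trans H _; exact: card_image_le.
Qed.

Lemma size_datum (g : nat -> nat) : exists D : datum, (fun n => size (D n)) = g.
Proof.
by exists (fun n => nseq (g n) 0); apply/funext => n; rewrite size_nseq.
Qed.

(** Since [s a] is sparse for the growth functions of all indices up to [a], the
    exceptions for the growth function coded by [b] lie strictly below [b]; this
    is why [R a b], an initial segment, bounds the exceptional set. *)
Lemma sparse_catching_family (T : Type) (kappa : set T) :
  is_bfrak kappa -> kappa #= [set: nat -> bool] ->
  exists (s : datum -> cantor_space) (R : datum -> datum -> Prop),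
  [/\ forall b, ~ R b b,
      forall b, ~ (kappa #<= [set a | R a b]),
      forall a, infinitely_often (fun n => s a n) /\
        infinitely_often (fun n => ~~ s a n) &
      (forall g, exists b, forall a, ~ R a b -> sparse_for g (s a)) /\
      forall D, infinitely_often (block D) ->
        exists a, infinitely_often (fun n => block D n /\ caught D (s a) n)].
Proof.
move=> hb hbc; have [R [totR irrR smallR]] := small_initial_segments datum.
have Rk b : ~ (kappa #<= [set a | R a b]).
  move=> H; apply: (smallR b); apply: card_le_trans H.
  by rewrite (card_le_eqr hbc); exact: card_graph.
pose sz (D : datum) n := size (D n).
have /choice[h Hh] : forall a, exists h, forall b, ~ R a b ->
    exists N, forall n, (N <= n)%N -> (sz b n <= h n)%N.
  move=> a; have [f Hf] := small_bounded sz hb (@Rk a).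
  exists (fun n => maxn (f n) (sz a n)) => b nab.
  have [//|<-|ba] := totR a b.
    by exists 0%N => n _; rewrite leq_maxr.
  have /le_starP[N HN] := Hf _ ba.
  by exists N => n /HN; rewrite leq_max => ->.
have /choice[s Hs] : forall a : datum, exists s : cantor_space,
    [/\ infinitely_often (fun n => s n),
      infinitely_often (fun n => ~~ s n), sparse_for (h a) s &
      infinitely_often (block a) ->
      infinitely_often (fun n => block a n /\ caught a s n)].
  move=> a; have [blk|nblk] := pselect (infinitely_often (block a)).
    by have [s [s1 s2 s3 s4]] := block_union (h a) blk; exists s.
  (* An index that codes no usable blocks still gets a sparse infinite set. *)
  have [N|s [s1 s2 s3 s4]] := @block_union (h a) (fun n => [:: n]);
    last by exists s.
  by exists N => //; split=> // m; rewrite inE => /eqP ->.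
exists s, R; split=> //.
  by move=> a; case: (Hs a).
split.
- move=> g; have [b bg] := size_datum g; exists b => a /Hh[N HN].
  case: (Hs a) => _ _ + _; apply: (@sparse_for_le _ _ _ N) => n /HN.
  by rewrite -bg.
- by move=> D HD; exists D; case: (Hs D) => _ _ _; exact.
Qed.

(** * Gaps force the enumeration to grow *)

Lemma unbounded_infinite s :
  infinitely_often (fun n => s n) -> infinite_subsets s.
Proof.
by move=> H /Fin_bounded[M HM]; have [n Mn /HM] := H M; rewrite ltnNge Mn.
Qed.

Lemma enumeration_spec s : infinitely_often (fun n => s n) ->
  {homo enumeration s : m n / (m < n)%N} /\ range (enumeration s) = carrier s.
Proof.
move=> inf; rewrite /enumeration; case: xgetP => [f -> //|/= nof].
have exn N : exists n, (N <= n)%N && s n.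
  by have [n Nn sn] := inf N; exists n; rewrite Nn.
pose next N := ex_minn (exn N).
pose f := fix f k := if k is j.+1 then next (f j).+1 else next 0%N.
have sf k : s (f k).
  by case: k => [|k] /=; rewrite /next; case: ex_minnP => m /andP[].
have fS k : (f k < f k.+1)%N by rewrite /= /next; case: ex_minnP => m /andP[].
have f_lt m n : (m < n)%N -> (f m < f n)%N.
  elim: n => // n IH; rewrite ltnS leq_eqVlt => /orP[/eqP ->//|/IH h].
  exact: ltn_trans h (fS n).
case: (nof f); split => //; apply/seteqP.
split=> [_ [k _ <-]|i /= si]; first exact: sf.
have f_ge k : (k <= f k)%N.
  by elim: k => // k IH; exact: leq_ltn_trans IH (fS k).
have exk : exists k, (i <= f k)%N by exists i.
case: (ex_minnP exk) => k ik kmin.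
exists k => //; apply/eqP; rewrite eqn_leq ik andbT.
case: k ik kmin => [|k] ik kmin; rewrite /= /next; case: ex_minnP => m _; apply.
  by rewrite si.
by rewrite si andbT ltnNge; apply/negP => /kmin; rewrite ltnn.
Qed.

(** If [k] is least with [m <= enumeration s k], then [k <= m], and the gap
    [[m, K m)] pushes this value to at least [K m], above every [b k] with
    [k <= m]. *)
Lemma gappy_not_le_star b s : infinitely_often (fun n => s n) ->
  gappy (fun n => (majorant b n).+1) s -> ~ le_star (enumeration s) b.
Proof.
move=> inf [N HN] /le_starP[M HM].
have [] := enumeration_spec inf; set f := enumeration s => f_lt fr.
have sf k : s (f k) by have : range f (f k) by []; rewrite fr.
have f_ge k : (k <= f k)%N.
  by elim: k => // k IH; apply: leq_ltn_trans IH (f_lt _ _ (ltnSn k)).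
have [|m [nm g]] := HN (maxn N (f M).+1); first lia.
have exk : exists k, (m <= f k)%N by exists m.
case: (ex_minnP exk) => k mk kmin.
have km : (k <= m)%N by exact: kmin (f_ge m).
have Mk : (M <= k)%N.
  by rewrite leqNgt; apply/negP => /f_lt; move/andP: nm => [nm _]; lia.
have := g (f k); rewrite sf mk /= => /(_ _) H.
have : ~ (f k < (majorant b m).+1)%N by move=> /H.
apply; have Hk : (f k <= b k)%N := HM _ Mk; have := majorant_ge b km; lia.
Qed.

(** * Selection principles for concentrated sets *)

(** The property that a set with fewer than b elements has; it is stated
    without cardinals because the covering arguments use only this. *)
Definition star_bounded_under_maps (E : set cantor_space) : Prop :=
  forall Phi : cantor_space -> nat -> nat,
  exists f, forall x, E x -> le_star (Phi x) f.

Definition gap_concentrated (S : set cantor_space) : Prop :=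
  forall K : nat -> nat, (forall n, (n < K n)%N) ->
  exists E, star_bounded_under_maps E /\ forall x, S x -> ~ E x -> gappy K x.

Lemma Fin_gappy (K : nat -> nat) x :
  (forall n, (n < K n)%N) -> Fin x -> gappy K x.
Proof.
move=> KS /Fin_bounded[M HM]; exists M => n Mn; exists n; split.
  by rewrite leqnn /escape; have := leq_iter KS (K n).+2 n; lia.
by move=> i /andP[ni _]; apply/negP => /HM; lia.
Qed.

(** Infinity of the range is automatic.  If finitely many sets occurred, choose
    a point outside each of them; for large [n] the set [V n] contains all these
    points, among them the one chosen outside [V n]. *)
Lemma range_gamma_cover (X : topologicalType) (V : nat -> set X) :
  (forall n, open (V n)) -> (forall n, V n <> setT) ->
  (forall z, exists N, forall n, (N <= n)%N -> V n z) -> gamma_cover (range V).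
Proof.
move=> oV VT /choice[N HN]; split.
- move=> fV.
  have /choice[z Hz] : forall u : set X, exists n, range V u ->
      exists2 z, ~ u z & (N z <= n)%N.
    move=> u; have [[n _ <-]|nu] := pselect (range V u); last by exists 0%N.
    have [z nz] : exists z, ~ V n z.
      by apply/existsNP => VnT; apply: (VT n); apply/seteqP; split.
    by exists (N z) => _; exists z.
  have /finite_nat_bounded[M HM] := finite_image z fV.
  have [|x nx Nx] := Hz (V M); first by exists M.
  apply: nx; apply: HN; apply: leq_trans Nx _; apply: ltnW; apply: HM.
  by exists (V M) => //; exists M.
- split; last by move=> u [n _ <-].
  split; last by move=> [n _ /VT].
  apply/seteqP; split=> // z _; exists (V (N z)); first by exists (N z).
  exact: HN.
- move=> z; apply: (@sub_finite_set _ _ (V @` `I_(N z))).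
    move=> u [[n _ <-] nu]; exists n => //=; rewrite ltnNge; apply/negP => /HN.
    exact: nu.
  exact/finite_image/finite_II.
Qed.

(** [cyl n d x]: the cylinder of length [d] around [x] is inside one member of
    the n-th cover.  There are finitely many cylinders of length [d], so all
    points with [cyl n (D n)] are covered by finitely many members.  For gappy
    points, the depth needed at stage [n] is at most [K (escape K n)]; for the
    exceptional points a bound [f] is provided by the concentration. *)
Lemma concentrated_Ufin (S : set cantor_space) :
  gap_concentrated S -> Ufin_O_Gamma (set_type (S `|` Fin)).
Proof.
move=> conc; set X := set_type _ => U oU nU.
pose cyl n d x :=
  exists2 u : set X, U n u & forall z, agree d x (set_val z) -> u z.
have cyl_mono n d e x : (d <= e)%N -> cyl n d x -> cyl n e x.
  by move=> de [u Uu Hu]; exists u => // z /(agree_weaken de); exact: Hu.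
have cyl_agree n d x y : agree d x y -> cyl n d x -> cyl n d y.
  by move=> xy [u Uu Hu]; exists u => // z /(agree_trans xy); exact: Hu.
have cyl_cover n (z : X) : exists d, cyl n d (set_val z).
  have [[UT _] Uo] := oU n.
  have [u Uu uz] : (\bigcup_(u in U n) u) z by rewrite UT.
  have /open_set_typeP/(_ _ uz)[d Hd] := Uo _ Uu.
  by exists d, u.
have /choice[k Hk] : forall n, exists k : nat -> nat,
    forall m x e, (k m <= e)%N -> gap x m e -> cyl n e x.
  move=> n; apply: gap_capture; [exact: cyl_mono|exact: cyl_agree|].
  move=> x Fx; have [|z <-] := set_type_point (A := S `|` Fin) (a := x).
    by right.
  exact: cyl_cover.
pose K := majorant (fun m => \sum_(n < m.+1) k n m).
have KS n : (n < K n)%N by exact: majorant_gt.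
have kK n m : (n <= m)%N -> (k n m <= K m)%N.
  move=> nm; apply: leq_trans (majorant_ge _ (leqnn m)).
  by rewrite (bigD1 (Ordinal (nm : (n < m.+1)%N))) //= leq_addr.
have [E [Ebd ES]] := conc K KS.
have /choice[Phi HPhi] : forall x, exists f : nat -> nat, forall n,
    (S `|` Fin) x -> cyl n (f n) x.
  move=> x; have [Ax|nx] := pselect ((S `|` Fin) x); last by exists (fun=> 0%N).
  have [z <-] := set_type_point Ax.
  have /choice[f Hf] : forall n, exists d, cyl n d (set_val z).
    by move=> n; exact: cyl_cover.
  by exists f.
have [f Hf] := Ebd Phi.
pose D n := maxn (K (escape K n)) (f n).
pose ext n (t : (D n).-tuple bool) : cantor_space := nth false t.
have /choice[pick Hpick] : forall n, exists p : cantor_space -> set X,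
    forall x, cyl n (D n) x ->
    U n (p x) /\ forall z, agree (D n) x (set_val z) -> p x z.
  move=> n; have /choice[p Hp] : forall x, exists p, cyl n (D n) x ->
      U n p /\ forall z : X, agree (D n) x (set_val z) -> p z.
    move=> x; have [[u Uu Hu]|nc] := pselect (cyl n (D n) x); first by exists u.
    by exists setT.
  by exists p.
pose F n := range (fun t => pick n (ext n t)) `&` U n.
have FU n : F n `<=` U n by move=> u [].
have finF n : finite_set (F n).
  by apply: finite_setIl; apply: finite_image; exact: finite_finset.
have cylF n z : cyl n (D n) (set_val z) -> (\bigcup_(u in F n) u) z.
  move=> cz; pose t := [tuple (set_val z) i | i < D n].
  have zt : agree (D n) (ext n t) (set_val z).
    move=> i iD; rewrite /ext -[i]/(val (Ordinal iD)) -tnth_nth tnth_mktuple //.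
  have [Up pz] := Hpick n (ext n t) (cyl_agree _ _ _ _ (agree_sym zt) cz).
  by exists (pick n (ext n t)); [split => //; exists t|exact: pz].
exists F; split=> //; apply: range_gamma_cover.
- by move=> n; apply: bigcup_open => u /FU; case: (oU n) => _; exact.
- move=> n FT; apply: (nU n); exists (F n); split=> //; split=> // /FU.
  by case: (oU n) => -[].
- move=> z.
  suff [N HN] : exists N, forall n, (N <= n)%N -> cyl n (D n) (set_val z).
    by exists N => n /HN /cylF.
  have Az : (S `|` Fin) (set_val z) by exact: set_valP.
  have [Ez|nEz] := pselect (E (set_val z)).
    have /le_starP[N HN] := Hf _ Ez; exists N => n /HN fn.
    by apply: cyl_mono (HPhi _ n Az); rewrite /D; lia.
  have [N HN] : gappy K (set_val z).
    by case: Az => [Sz|Fz]; [exact: ES|exact: Fin_gappy].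
  exists N => n /HN[m [/andP[nm me] gm]].
  apply: (@cyl_mono _ (K m)); last by apply: Hk gm; exact: kK.
  have := majorant_mono (fun m => \sum_(n < m.+1) k n m) me.
  by rewrite -/K /D; lia.
Qed.

Lemma Fin_seq x : Fin x -> exists l : seq nat, forall i, x i = (i \in l).
Proof.
move=> /finite_seqP[l xl]; exists l => i.
apply/idP/idP => h; first by have : carrier x i by []; rewrite xl.
by have : [set` l] i by []; rewrite -xl.
Qed.

(** The covers with even index are spent on Fin, whose elements are enumerated
    by codes of lists; they then cover all gappy points.  The covers with odd
    index are spent on the exceptional points: each such point is in all but
    finitely many members of a sequence [e n] of the n-th of these covers, so a
    bound [f] modulo finite selects a suitable member. *)
Lemma concentrated_S1 (S : set cantor_space) :
  gap_concentrated S -> S1_Gamma_O (set_type (S `|` Fin)).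
Proof.
move=> conc; set X := set_type _ => U gU.
have Uopen n u : U n u -> open u by case: (gU n) => _ [_ +] _; exact.
have UT n : ~ U n setT by case: (gU n) => _ [[]].
have Ucov n z : exists2 u, U n u & u z.
  case: (gU n) => _ [[UnT _] _] _.
  have [u Uu uz] : (\bigcup_(u in U n) u) z by rewrite UnT.
  by exists u.
have /choice[v Hv] : forall k, exists u, U k.*2 u /\
    forall (l : seq nat) (z : X), unpickle k = Some l ->
      (forall i, set_val z i = (i \in l)) -> u z.
  move=> k; have [[l [z [kl zl]]]|no] := pselect (exists (l : seq nat) (z : X),
      unpickle k = Some l /\ forall i, set_val z i = (i \in l)).
    have [u Uu uz] := Ucov k.*2 z; exists u; split=> // l' z'.
    rewrite kl => -[<-] zl'; suff -> : z' = z by [].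
    by apply: val_inj; apply/funext => i; exact: etrans (zl' i) (esym (zl i)).
  have [u Uu] : U k.*2 !=set0 by apply: infinite_setN0; case: (gU k.*2).
  by exists u; split=> // l z kl zl; case: no; exists l, z.
pose W d x := forall z : X, agree d x (set_val z) -> exists k, v k z.
have [k Hk] : exists k : nat -> nat,
    forall m x e, (k m <= e)%N -> gap x m e -> W e x.
  apply: gap_capture.
  - by move=> d e x de Wx z /(agree_weaken de); exact: Wx.
  - by move=> d x y xy Wx z /(agree_trans xy); exact: Wx.
  - move=> x Fx; have [|z zx] := set_type_point (A := S `|` Fin) (a := x).
      by right.
    have [l xl] := Fin_seq Fx.
    have vz : v (pickle l) z.
      case: (Hv (pickle l)) => _; apply; first exact: pickleK.
      by rewrite zx.
    have /open_set_typeP/(_ _ vz)[d Hd] : open (v (pickle l)).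
      by apply: Uopen; case: (Hv (pickle l)) => + _; exact.
    by exists d; rewrite -zx => z' /Hd; exists (pickle l).
pose K := majorant k.
have [E [Ebd ES]] := conc K (majorant_gt k).
have vcov z : gappy K (set_val z) -> exists j, v j z.
  move=> [N /(_ _ (leqnn N))[m [_ gm]]].
  exact: (Hk m _ (K m) (majorant_ge _ (leqnn m)) gm).
have /choice[e He] : forall n, exists e : nat -> set X,
    (forall j, U n.*2.+1 (e j)) /\ injective e.
  move=> n; case: (gU n.*2.+1) => /infiniteP/pcard_leP[e] _ _.
  exists e; split=> [j|i j]; first exact: (@funS _ _ _ _ e).
  by apply: (@inj _ _ _ e); rewrite ?inE.
have /choice[Phi HPhi] : forall x, exists f : nat -> nat, forall n (z : X),
    set_val z = x -> forall j, (f n <= j)%N -> e n j z.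
  move=> x; have [Ax|nx] := pselect ((S `|` Fin) x); last first.
    by exists (fun=> 0%N) => n z zx; case: nx; rewrite -zx; exact: set_valP.
  have [z zx] := set_type_point Ax.
  have /choice[f Hf] : forall n, exists N, forall j, (N <= j)%N -> e n j z.
    move=> n; have [en einj] := He n.
    have [_ _ /(_ z)] := gU n.*2.+1; set B := mkset _ => finB.
    have /finite_nat_bounded[N HN] : finite_set [set j | ~ e n j z].
      apply: card_le_finite finB; apply: (@card_le_inj _ _ _ _ (e n)).
        by move=> j nj; split.
      by move=> i j _ _; exact: einj.
    exists N => j Nj; apply: contrapT => /HN; rewrite ltnNge Nj //.
  exists f => n z' z'x j; suff -> : z' = z by exact: Hf.
  by apply: val_inj; exact: etrans z'x (esym zx).
have [f Hf] := Ebd Phi.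
pose u n := if odd n then e n./2 (f n./2) else v n./2.
have Uu n : U n (u n).
  rewrite /u -{1}[n]odd_double_half; case: (odd n).
    by case: (He n./2).
  by case: (Hv n./2).
have vu j : range u (v j).
  by exists j.*2 => //; rewrite /u odd_double doubleK.
exists u; split=> //; split; last by move=> w [n _ <-]; exact: Uopen.
split; last by move=> [n _ uT]; apply: (UT n); rewrite -uT.
apply/seteqP; split=> // z _.
have Az : (S `|` Fin) (set_val z) by exact: set_valP.
have [Ez|nEz] := pselect (E (set_val z)).
  have /le_starP[N HN] := Hf _ Ez.
  exists (u N.*2.+1); first by exists N.*2.+1.
  rewrite /u /= odd_double /= uphalf_double.
  by apply: (HPhi (set_val z)) => //; exact: HN.
have [j vj] : exists j, v j z.
  apply: vcov; case: Az => [Sz|Fz]; first exact: ES.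
  by apply: Fin_gappy => //; exact: majorant_gt.
by exists (v j).
Qed.

(** * Failure of U_id *)

(** By the first alternative a sparse set can mark any [n.+1] given numbers from
    [n] on; by the second one an interval can mark any finite set of numbers
    from [n] on, which excludes finite subcovers. *)
Definition marked (n m : nat) x : Prop :=
  x m /\ ((cnt x n m <= n)%N \/ forall i, (n <= i <= m)%N -> x i).

Lemma agree_cnt d n m x y : agree d x y -> (m <= d)%N -> cnt x n m = cnt y n m.
Proof.
move=> xy md; apply: eq_big_nat => i /andP[_ im].
by rewrite xy //; exact: leq_trans md.
Qed.

Lemma agree_marked n m x y : agree m.+1 x y -> marked n m x -> marked n m y.
Proof.
move=> xy [xm xn]; split; first by rewrite -xy.
case: xn => [c|H]; [left|right].
  by rewrite -(agree_cnt _ xy).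
by move=> i nim; rewrite -xy ?H //; case/andP: nim.
Qed.

Lemma cnt_eventually_ge x n c :
  exists N, forall m, (N <= m)%N -> x m -> (c <= cnt x n m)%N.
Proof.
elim: c => [|c [N HN]]; first by exists 0%N.
have [[p Np xp]|no] := pselect (exists2 p, (maxn n N <= p)%N & x p); last first.
  by exists (maxn n N) => m Nm xm; case: no; exists m.
exists p.+1 => m pm _; have np : (n <= p)%N by lia.
rewrite (cnt_cat x np (ltnW pm)) (cnt_cat x (leqnSn p) pm) {2}/cnt big_nat1 xp.
by have := HN p; rewrite xp => /(_ _ isT); lia.
Qed.

Lemma marked_finite n x : infinitely_often (fun p => ~~ x p) ->
  exists N, forall m, (N <= m)%N -> ~ marked n m x.
Proof.
move=> /(_ n)[p np xp]; have [N HN] := cnt_eventually_ge x n n.+1.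
exists (maxn N p) => m Nm [xm [c|/(_ p)]].
  by have := HN m; rewrite xm => /(_ _ isT); lia.
by rewrite np (leq_trans (leq_maxr _ _) Nm) (negbTE xp) => /(_ isT).
Qed.

Lemma Fin_coinfinite x : Fin x -> infinitely_often (fun p => ~~ x p).
Proof.
move=> /Fin_bounded[M HM] N; exists (maxn N M); first exact: leq_maxl.
by apply/negP => /HM; lia.
Qed.

(** Reads a selection of at most [b] members of a cover as a list of labels.
    Positions outside the image of the injection into [`I_b] are filled with
    [n], so that the list has length exactly [b]. *)
Lemma card_le_I_enum (T : Type) (A : set T) (b : nat)
    (P : nat -> T -> Prop) (n : nat) :
  A #<= `I_b -> (forall u, A u -> exists2 m, (n <= m)%N & P m u) ->
  exists l : seq nat, [/\ size l = b, forall m, m \in l -> (n <= m)%N &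
    forall u, A u -> exists2 m, m \in l & P m u].
Proof.
move=> /pcard_leP[f] HA.
have /choice[c Hc] : forall j, exists m,
    (n <= m)%N /\ forall u, A u -> f u = j -> P m u.
  move=> j; have [[u [Au fu]]|no] := pselect (exists u, A u /\ f u = j).
    have [m nm Pm] := HA u Au; exists m; split=> // w Aw fw.
    suff -> : w = u by [].
    by apply: (@inj _ _ _ f); rewrite ?inE //; exact: etrans fw (esym fu).
  by exists n; split=> // u Au fu; case: no; exists u.
exists [seq c j | j <- iota 0 b]; split.
- by rewrite size_map size_iota.
- by move=> m /mapP[j _ ->]; case: (Hc j).
- move=> u Au; exists (c (f u)); last by case: (Hc (f u)) => _; exact.
  apply/mapP; exists (f u) => //; rewrite mem_iota add0n /=.
  exact: (@funS _ _ _ _ f).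
Qed.

(** A selection [F] yields lists [D n].  Since a gamma-cover is a set and not a
    sequence, a point missed for infinitely many [n] need not be missed by
    infinitely many members; hence only those [n] are kept at which the union
    [G n] occurs for the first time.  There are infinitely many of them, and
    [G] is injective on them. *)
Lemma catching_not_Uid (S : set cantor_space) :
  (forall x, S x -> infinitely_often (fun p => ~~ x p)) ->
  (forall D, infinitely_often (block D) ->
    exists2 x, S x & infinitely_often (fun n => block D n /\ caught D x n)) ->
  ~ Uid_Gamma_Gamma (set_type (S `|` Fin)).
Proof.
move=> coS catch; set X := set_type _ => uid.
pose V n k : set X := [set z | ~ marked n (n + k) (set_val z)].
have itv n M : exists z : X, forall k, (k <= M)%N -> ~ V n k z.
  (* All elements of this interval are marked, by the second alternative. *)
  pose x : cantor_space := fun i => (n <= i <= n + M)%N.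
  have [|z zx] := set_type_point (A := S `|` Fin) (a := x).
    by right; apply/Fin_bounded; exists (n + M).+1 => i /andP[].
  exists z => k kM; rewrite /V /=; apply; rewrite zx.
  split; first by rewrite /x; lia.
  by right => i nik; rewrite /x; lia.
have gV n : gamma_cover (range (V n)).
  apply: range_gamma_cover.
  - move=> k; apply/open_set_typeP => z Vz; exists (n + k).+1 => z' zz'.
    by move=> mz'; apply: Vz; apply: agree_marked mz'; exact: agree_sym.
  - move=> k VT; have [z /(_ _ (leqnn k))] := itv n k; rewrite VT; exact.
  - move=> z; have [|N HN] := @marked_finite n (set_val z).
      have : (S `|` Fin) (set_val z) by exact: set_valP.
      by case=> [/coS|/Fin_coinfinite].
    by exists N => k Nk; apply: HN; lia.
have nV n : ~ has_finite_subcover (range (V n)).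
  move=> [F [FV fF [FT _]]].
  have /choice[c Hc] : forall u, exists k, F u -> u = V n k.
    move=> u; have [/FV[k _ <-]|nF] := pselect (F u); first by exists k.
    by exists 0%N.
  have /finite_nat_bounded[M HM] := finite_image c fF.
  have [z Hz] := itv n M.
  have [u Fu uz] : (\bigcup_(u in F) u) z by rewrite FT.
  have cM : (c u <= M)%N by apply/ltnW/HM; exists u.
  by apply: (Hz _ cM); rewrite -(Hc u Fu).
have [F [HF gF]] := uid (fun n => range (V n)) gV nV.
pose G n := \bigcup_(u in F n) u.
have /choice[D HD] : forall n, exists l : seq nat, [/\ size l = n.+1,
    forall m, m \in l -> (n <= m)%N &
    forall u, F n u -> exists2 m, m \in l & u = V n (m - n)%N].
  move=> n; have [FV cF] := HF n.
  apply: (card_le_I_enum (P := fun m u => u = V n (m - n)%N) cF).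
  move=> u /FV[k _ <-].
  by exists (n + k); [exact: leq_addr|rewrite addKn].
pose first n := forall n', (n' < n)%N -> G n' <> G n.
have firstP n : exists2 m, first m & G m = G n.
  have ex : exists m, `[< G m = G n >] by exists n; exact/asboolP.
  case: (ex_minnP ex) => m /asboolP mn mmin; exists m => // n' n'm GG.
  have /mmin : `[< G n' = G n >] by apply/asboolP; exact: etrans GG mn.
  by rewrite leqNgt n'm.
pose D' n := if `[< first n >] then D n else [::].
have [|x Sx caughtx] := catch D'.
  move=> N; apply: contrapT => no.
  have [infG _ _] := gF; apply: infG.
  apply: (@sub_finite_set _ _ (G @` `I_N)); last exact/finite_image/finite_II.
  move=> _ [n _ <-]; have [m fm mn] := firstP n; exists m; last exact: mn.
  rewrite /= ltnNge; apply/negP => Nm; apply: no; exists m => //.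
  have [sD Dm _] := HD m; rewrite /block /D'.
  case: asboolP => // _; split=> //; last by rewrite sD.
  by move=> D0; rewrite D0 in sD.
have [|z zx] := set_type_point (A := S `|` Fin) (a := x); first by left.
have [_ _ /(_ z)] := gF; set B := mkset _ => finB.
have /finite_nat_bounded[N HN] : finite_set [set n | first n /\ ~ G n z].
  apply: card_le_finite finB; apply: (@card_le_inj _ _ _ _ G).
    by move=> n [_ nGz]; split; first by exists n.
  move=> i j; rewrite !inE => -[fi _] [fj _] Gij.
  have [ij|ji|//] := ltngtP i j; first by case: (fj _ ij).
  by case: (fi _ ji).
have [n Nn [[]]] := caughtx N; rewrite /caught /D'.
case: asboolP => // fn _ _ _ cx.
suff /HN : first n /\ ~ G n z by rewrite ltnNge Nn.
split=> // -[u Fu uz]; have [_ Dn /(_ _ Fu)[m mD uV]] := HD n.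
have [xm cm] := cx _ mD.
move: uz; rewrite uV /V /= zx subnKC; last exact: Dn.
by apply; split; [|left].
Qed.

(** * The theorem *)

Theorem theorem10p6 (T : Type) (kappa : set T) (hb : is_bfrak kappa)
    (hbc : kappa #= [set: nat -> bool]) :
  exists S : set cantor_space,
    [/\ card_unbounded kappa S,
        Ufin_O_Gamma (set_type (S `|` Fin)),
        S1_Gamma_O (set_type (S `|` Fin)) &
        ~ Uid_Gamma_Gamma (set_type (S `|` Fin))].
Proof.
have [s [R [Rirr Rk s_inf [s_sparse s_catch]]]] :=
  sparse_catching_family hb hbc.
have inf a : infinitely_often (fun n => s a n) by case: (s_inf a).
have coinf a : infinitely_often (fun n => ~~ s a n) by case: (s_inf a).
have gappy_tail K : (forall n, (n < K n)%N) ->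
    exists b, forall a, ~ R a b -> gappy K (s a).
  move=> KS; have [b Hb] := s_sparse (escape K); exists b => a /Hb.
  exact: sparse_gappy.
have small b : ~ (kappa #<= s @` [set a | R a b]).
  by move=> H; apply: (Rk b); apply: card_le_trans H _; exact: card_image_le.
have conc : gap_concentrated (range s).
  move=> K /gappy_tail[b Hb]; exists (s @` [set a | R a b]); split.
    by move=> Phi; exact: small_bounded hb (small b).
  by move=> _ [a _ <-] nR; apply: Hb => Rab; apply: nR; exists a.
have unb (f : nat -> nat) :
    exists b, forall a, ~ R a b -> ~ le_star (enumeration (s a)) f.
  have [|b Hb] := gappy_tail (fun n => (majorant f n).+1).
    by move=> n; have := majorant_gt f n; lia.
  by exists b => a /Hb; apply: gappy_not_le_star; exact: inf.
exists (range s); split.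
- split.
  + by move=> _ [a _ <-]; exact: unbounded_infinite.
  (* If [S] had fewer than b elements, its enumerations would have a common
     bound modulo finite. *)
  + apply: contrapT => nk.
    have [f Hf] := small_bounded enumeration hb nk.
    have [b Hb] := unb f.
    by apply: (Hb b (Rirr b)); apply: Hf; exists b.
  + move=> f; split.
      rewrite (card_le_eqr hbc).
      by apply: (@card_le_inj _ _ _ _
        (fun x : cantor_space => (x : nat -> bool))).
    have [b Hb] := unb f; move=> H; apply: (small b); apply: card_le_trans H _.
    apply: subset_card_le => _ [[a _ <-] sf]; exists a => //=.
    apply: contrapT => nR.
    by apply: (Hb a nR); apply/le_starP; exists 0%N.
- exact: concentrated_Ufin.
- exact: concentrated_S1.
- apply: catching_not_Uid => [_ [a _ <-]|D HD]; first exact: coinf.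
  by have [a Ha] := s_catch D HD; exists (s a) => //; exists a.
Qed.
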